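(* Let $\lambda$ be a partition of size $|\lambda|\ge1$, and let $j\ge0$ be an integer. Then there exists a polynomial $b^{(j)}\in\mathbb{Q}[n]$ (depending on $\lambda$ and $j$) of degree at most $|\lambda|+2j$ such that $$A^{\lambda[n]}_{\mathrm{id}_{n-j}}=\frac{b^{(j)}(n)}{n!}$$ for all integers $n\ge\max(j,|\lambda|-1)$.
   Context: For $\pi\in S_n$ and $k\ge0$, $N_{\mathrm{id}_k}(\pi)$ is the number of index sequences $1\le i_1<\dots<i_k\le n$ with $\pi(i_1)<\dots<\pi(i_k)$ (so $N_{\mathrm{id}_0}(\pi)=1$). For $j\ge1$, $m_j:\bigsqcup_{n\ge0}S_n\to\mathbb{Z}_{\ge0}$ is the function counting $j$-cycles of a permutation; for a partition $\rho$, $m_j(\rho)$ is the number of parts of size $j$, and $I_\rho:=\prod_{j\ge1}\binom{m_j}{m_j(\rho)}\in\mathbb{Q}[m_1,m_2,\dots]$. For partitions $\mu,\rho$ of the same size, $\chi^\mu_\rho$ is the value of the irreducible symmetric group character $\chi^\mu$ on permutations of cycle type $\rho$. Put $Y^\mu:=\sum_{\rho\vdash|\mu|}\chi^\mu_\rho I_\rho$ and $X^\lambda:=\sum_{\mu\prec'\lambda}(-1)^{|\lambda|-|\mu|}Y^\mu$, where $\mu\prec'\lambda$ means that $\mu$ is a partition obtained from $\lambda$ by removing at most one box in each row. (By a theorem of Macdonald, $X^\lambda(\pi)=\chi^{\lambda[n]}(\pi)$ for $\pi\in S_n$ with $n\ge|\lambda|+\lambda_1$, where $\lambda[n]=(n-|\lambda|,\lambda_1,\lambda_2,\dots)$.)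 For all $n,k\ge0$ define $A^{\lambda[n]}_{\mathrm{id}_k}:=\frac1{n!}\sum_{\pi\in S_n}X^\lambda(\pi)N_{\mathrm{id}_k}(\pi)$. *)

(* Defs.v *)
From mathcomp Require Import all_boot all_order all_fingroup all_algebra.
From mathcomp Require Import mxrepresentation.

Set Implicit Arguments.
Unset Strict Implicit.
Unset Printing Implicit Defensive.

Import GroupScope GRing.Theory.
Local Open Scope ring_scope.

(* A partition is the weakly decreasing sequence of its (positive) parts. *)
Definition is_part (mu : seq nat) : bool := sorted geq mu && (0%N \notin mu).

Definition is_part_of (d : nat) (mu : seq nat) : bool :=
  is_part mu && (sumn mu == d).

(* A partition of d has at most d parts, all of them at most d, so that the
   finite type of sequences below contains each partition of d exactly once. *)
Definition partitions (d : nat) : seq (seq nat) :=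
  [seq mu <- [seq map val t | t : d.-bseq 'I_d.+1] | is_part_of d mu].

Definition num_cycles (n : nat) (s : 'S_n) (j : nat) : nat :=
  #|[set c in porbits s | #|c| == j]|.

Definition cycle_type (n : nat) (s : 'S_n) : seq nat :=
  sort geq [seq #|(c : {set 'I_n})| | c <- enum (porbits s)].

Definition num_id (n k : nat) (s : 'S_n) : nat :=
  #|[set t : k.-tuple 'I_n | sorted ltn [seq val i | i <- t]
                           & sorted ltn [seq val (s i) | i <- t]]|.

Section Specht.

Variable mu : seq nat.

(* The boxes of mu are numbered 0, 1, 2, ... row by row: box i lies in row
   reshape_index mu i and in column reshape_offset mu i. *)
Definition row_group : {set 'S_(sumn mu)} :=
  [set p : 'S_(sumn mu) |
     [forall i, reshape_index mu (p i) == reshape_index mu i]].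

Definition col_group : {set 'S_(sumn mu)} :=
  [set q : 'S_(sumn mu) |
     [forall i, reshape_offset mu (q i) == reshape_offset mu i]].

(* The Young symmetrizer \sum_p \sum_q sgn(q) (p * q), as a row vector of
   coordinates in the group algebra of S_|mu|. *)
Definition young_symmetrizer : 'rV[rat]_#|[set: 'S_(sumn mu)]| :=
  \sum_(p in row_group) \sum_(q in col_group)
     (-1) ^+ q *: delta_mx 0 (gring_index [set: 'S_(sumn mu)] (p * q)%g).

(* The Specht module: the submodule of the regular representation that the
   Young symmetrizer generates. *)
Definition specht_repr :=
  submod_repr (cyclic_mx_module (regular_repr rat [set: 'S_(sumn mu)])
                                young_symmetrizer).

Definition specht_char (s : 'S_(sumn mu)) : rat := \tr (specht_repr s).

End Specht.

(* chi^mu_rho, for mu and rho of the same size: the value at some permutation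
   of cycle type rho (which one is irrelevant, as these are conjugate). *)
Definition chi (mu rho : seq nat) : rat :=
  specht_char (odflt 1%g [pick s : 'S_(sumn mu) | cycle_type s == rho]).

(* I_rho evaluated at s; the factors with j > |rho| are equal to 1. *)
Definition Ipoly (rho : seq nat) (n : nat) (s : 'S_n) : rat :=
  \prod_(1 <= j < (sumn rho).+1) 'C(num_cycles s j, count_mem j rho)%:R.

Definition Ypoly (mu : seq nat) (n : nat) (s : 'S_n) : rat :=
  \sum_(rho <- partitions (sumn mu)) chi mu rho * Ipoly rho s.

(* mu is obtained from la by removing at most one box in each row. *)
Definition vstrip (mu la : seq nat) : bool :=
  [forall i : 'I_(maxn (size mu) (size la)),
     (nth 0 mu i <= nth 0 la i <= (nth 0 mu i).+1)%N].

Definition Xpoly (la : seq nat) (n : nat) (s : 'S_n) : rat :=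
  \sum_(d < (sumn la).+1) \sum_(mu <- partitions d | vstrip mu la)
     (-1) ^+ (sumn la - sumn mu) * Ypoly mu s.

Definition A_id (la : seq nat) (n k : nat) : rat :=
  (n`!%:R)^-1 * \sum_(s : 'S_n) Xpoly la s * (num_id k s)%:R.

(* Main.v *)
Require Import Defs.
From mathcomp Require Import all_boot all_order all_fingroup all_algebra.
From mathcomp Require Import zify ring.

(** The character values play no role: each I_rho is a polynomial in the cycle
    counts m_r, so it suffices to treat a monomial f in the m_r, of weight a.
    Such an f(s) is, up to a factor, the number of words w of length n over a
    finite alphabet, of prescribed grade, with w o s = tau o w for a letter
    permutation tau: the trace of s twisted by tau. Moreover
    j! \sum_s N_{n-j}(s) (w o s) is obtained from w by deleting j letters one by
    one and reinserting them in arbitrary places, so \sum_s f(s) N_{n-j}(s) is a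
    twisted trace of products of deletion and insertion operators.

    Commuting an insertion with the other operators produces shorter products,
    and by cyclicity an insertion at one end moves to the other end at the cost
    of lowering n by one. For the blank letter X this is a difference equation
    in n; for any other letter the grade drops. Hence, by induction, every such
    trace is a polynomial in n from n = a - 1 on. *)

Set Implicit Arguments.
Unset Strict Implicit.
Unset Printing Implicit Defensive.

Import Order.TTheory GRing.Theory Num.Theory.
Local Open Scope ring_scope.

(** * Eventually polynomial functions *)

Definition poly_from (d m : nat) (f : nat -> rat) : Prop :=
  exists p : {poly rat},
    (size p <= d.+1)%N /\ forall n : nat, (m <= n)%N -> f n = p.[n%:R].

Lemma poly_from_ext d m f g :
  (forall n, (m <= n)%N -> f n = g n) -> poly_from d m f -> poly_from d m g.
Proof. by move=> fg [p [sp pE]]; exists p; split=> // n mn; rewrite -fg ?pE. Qed.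

Lemma poly_from_mono d d' m m' f : (d <= d')%N -> (m <= m')%N ->
  poly_from d m f -> poly_from d' m' f.
Proof.
move=> dd mm [p [sp pE]]; exists p; split; first exact: leq_trans sp _.
by move=> n mn; apply: pE; apply: leq_trans mn.
Qed.

Lemma poly_from_const d m q : poly_from d m (fun=> q).
Proof.
exists q%:P; split=> [|n _]; last by rewrite hornerC.
by rewrite (leq_trans (size_polyC_leq1 _)).
Qed.

Lemma poly_fromD d m f g : poly_from d m f -> poly_from d m g ->
  poly_from d m (fun n => f n + g n).
Proof.
move=> [p [sp pE]] [q [sq qE]]; exists (p + q); split=> [|n mn].
  by rewrite (leq_trans (size_polyD _ _)) // geq_max sp sq.
by rewrite hornerD pE ?qE.
Qed.

Lemma poly_fromZ d m q f : poly_from d m f -> poly_from d m (fun n => q * f n).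
Proof.
move=> [p [sp pE]]; exists (q *: p); split=> [|n mn].
  by rewrite (leq_trans (size_scale_leq _ _)).
by rewrite hornerZ pE.
Qed.

Lemma poly_from_sum d m (I : Type) (r : seq I) (P : pred I) F :
  (forall i, P i -> poly_from d m (F i)) ->
  poly_from d m (fun n => \sum_(i <- r | P i) F i n).
Proof.
move=> PF; elim: r => [|i r IH].
  by apply: poly_from_ext (poly_from_const d m 0) => n _; rewrite big_nil.
case Pi: (P i); last by apply: poly_from_ext IH => n _; rewrite big_cons Pi.
apply: poly_from_ext (poly_fromD (PF i Pi) IH) => n _.
by rewrite big_cons Pi.
Qed.

Lemma poly_from_sum_all d m (I : Type) (r : seq I) (P : pred I) F :
  all P r -> (forall i, P i -> poly_from d m (F i)) ->
  poly_from d m (fun n => \sum_(i <- r) F i n).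
Proof.
move=> Pr PF; apply: poly_from_ext (poly_from_sum r PF) => n _.
by elim: r Pr => [|i r IH]; rewrite ?big_nil //= !big_cons => /andP[-> /IH->].
Qed.

Lemma poly_fromM_linear d m q f : poly_from d m f ->
  poly_from d.+1 m (fun n => (n%:R + q) * f n).
Proof.
move=> [p [sp pE]]; exists (('X + q%:P) * p); split=> [|n mn].
  by rewrite (leq_trans (size_polyMleq _ _)) // size_XaddC.
by rewrite hornerM !hornerE pE.
Qed.

Lemma poly_from_shift d m f g : (forall n, f n.+1 = g n) ->
  poly_from d m g -> poly_from d m.+1 f.
Proof.
move=> fg [p [sp pE]]; exists (p \Po ('X - 1%:P)); split=> [|[|n]] //.
  by rewrite size_comp_poly2 // size_XsubC.
rewrite ltnS => mn; rewrite fg horner_comp !hornerE pE //.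
by rewrite -natr1 addrK.
Qed.

(** Induction on the degree: [b] is the difference of ['X^(d.+1)] and has leading coefficient
    [d.+1], so subtracting a multiple of [b] removes the top coefficient of [p]. *)
Lemma poly_antidiff d (p : {poly rat}) : (size p <= d)%N ->
  exists2 q : {poly rat}, (size q <= d.+1)%N &
    forall x, q.[x + 1] - q.[x] = p.[x].
Proof.
elim: d p => [|d IH] p sp.
  exists 0; rewrite ?size_poly0 // => x.
  by move: sp; rewrite leqn0 size_poly_eq0 => /eqP->; rewrite !horner0 subr0.
pose b : {poly rat} := ('X + 1%:P) ^+ d.+1 - 'X^(d.+1).
have bE : b = \sum_(i < d.+1) ('X^i *+ 'C(d.+1, i)).
  by rewrite /b polyC1 exprD1n big_ord_recr /= binn mulr1n addrK.
have szb : (size b <= d.+1)%N.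
  rewrite bE (leq_trans (size_sum _ _ _)) //; apply/bigmax_leqP => i _.
  by rewrite -scaler_nat (leq_trans (size_scale_leq _ _)) // size_polyXn.
have bd : b`_d = d.+1%:R.
  rewrite bE coef_sum big_ord_recr /= big1 ?add0r => [|i _].
    by rewrite coefMn coefXn eqxx binSn.
  by rewrite coefMn coefXn gtn_eqF ?mul0rn.
pose a := p`_d / d.+1%:R.
have [|q sq qE] := IH (p - a *: b).
  apply/leq_sizeP => i; rewrite leq_eqVlt => /orP[/eqP<-|di].
    by rewrite coefB coefZ bd /a divfK ?pnatr_eq0 // subrr.
  have p0 : p`_i = 0 by apply: (leq_sizeP _ _ sp).
  by rewrite coefB coefZ (leq_sizeP _ _ szb) // mulr0 subr0 p0.
exists (q + a *: 'X^(d.+1)) => [|x].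
  rewrite (leq_trans (size_polyD _ _)) // geq_max (leq_trans sq) //=.
  by rewrite (leq_trans (size_scale_leq _ _)) // size_polyXn.
have := qE x; rewrite /b !(hornerE, horner_exp) => E.
by rewrite opprD addrACA E -mulrBr subrK.
Qed.

Lemma poly_from_antidiff d m f g :
  (forall n, (m <= n)%N -> f n.+1 - f n = g n) ->
  poly_from d m g -> poly_from d.+1 m f.
Proof.
move=> fg [p [sp pE]]; have [q sq qE] := poly_antidiff sp.
(* The constant makes the polynomial agree with [f] at the starting point [m]. *)
exists (q + (f m - q.[m%:R])%:P); split.
  rewrite (leq_trans (size_polyD _ _)) // geq_max sq.
  by rewrite (leq_trans (size_polyC_leq1 _)).
move=> n /subnKC <-; elim: (n - m)%N => [|k IH]; rewrite hornerD hornerC.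
  by rewrite addn0 addrC subrK.
rewrite addnS -[f _](subrK (f (m + k)%N)) fg ?leq_addr // IH hornerD hornerC.
by rewrite pE ?leq_addr // -qE natr1 addrA subrK.
Qed.

(** The two polynomials agree at infinitely many integers and hence are equal, so the degree bound
    of the first combines with the range of the second. *)
Lemma poly_from_extend d d' m m' f : poly_from d m f -> poly_from d' m' f ->
  poly_from d m' f.
Proof.
move=> [p [sp pE]] [q [_ qE]]; exists p; split=> // n mn.
suff -> : p = q by apply: qE.
apply/eqP; rewrite -subr_eq0; apply/negPn/negP => r0.
pose s := [seq (maxn m m' + i)%:R : rat | i <- iota 0 (size (p - q))].
suff : (size s < size (p - q)%R)%N by rewrite size_map size_iota ltnn.
apply: max_poly_roots => //.
  apply/allP => x /mapP[i _ ->]; rewrite rootE hornerD hornerN.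
  by rewrite -pE -?qE ?subrr //; lia.
rewrite map_inj_in_uniq ?iota_uniq // => i j _ _ /eqP.
by rewrite eqr_nat eqn_add2l => /eqP.
Qed.

(** * Operators on words *)

Section WordOperators.

Variable T : finType.
Implicit Types (x y z : T) (w v : seq T) (psi : seq T -> rat).

(* [Rep x y] replaces one occurrence of y by x. *)
Inductive wop := Ins of T | Del of T | Rep of T & T.

(** Outcomes are listed with multiplicity, one for each place where the operator can act. *)
Fixpoint ins_outs x w :=
  (x :: w) :: if w is y :: w' then [seq y :: v | v <- ins_outs x w'] else [::].

Fixpoint del_outs x w :=
  if w is y :: w' then
    nseq (y == x) w' ++ [seq y :: v | v <- del_outs x w']
  else [::].

Fixpoint rep_outs x y w :=
  if w is z :: w' then
    nseq (z == y) (x :: w') ++ [seq z :: v | v <- rep_outs x y w']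
  else [::].

Definition outs (o : wop) : seq T -> seq (seq T) :=
  match o with
  | Ins x => ins_outs x
  | Del x => del_outs x
  | Rep x y => rep_outs x y
  end.

Definition wact1 o psi w : rat := \sum_(v <- outs o w) psi v.

(* The operators of B act on words from left to right: the first one is applied
   first, and psi is summed over the words that result. *)
Definition wact (B : seq wop) psi : seq T -> rat := foldr wact1 psi B.

Lemma big_nseq_bool (b : bool) w psi :
  \sum_(v <- nseq b w) psi v = b%:R * psi w.
Proof. by case: b; rewrite /= ?big_seq1 ?big_nil ?mul1r ?mul0r. Qed.

Lemma ins_nil x psi : wact1 (Ins x) psi [::] = psi [:: x].
Proof. by rewrite /wact1 big_seq1. Qed.

Lemma ins_cons x psi y w : wact1 (Ins x) psi (y :: w) =
  psi (x :: y :: w) + wact1 (Ins x) (fun v => psi (y :: v)) w.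
Proof. by rewrite /wact1 /= big_cons big_map. Qed.

Lemma del_nil x psi : wact1 (Del x) psi [::] = 0.
Proof. by rewrite /wact1 big_nil. Qed.

Lemma del_cons x psi y w : wact1 (Del x) psi (y :: w) =
  (y == x)%:R * psi w + wact1 (Del x) (fun v => psi (y :: v)) w.
Proof. by rewrite /wact1 /= big_cat big_nseq_bool big_map. Qed.

Lemma rep_nil x y psi : wact1 (Rep x y) psi [::] = 0.
Proof. by rewrite /wact1 big_nil. Qed.

Lemma rep_cons x y psi z w : wact1 (Rep x y) psi (z :: w) =
  (z == y)%:R * psi (x :: w) + wact1 (Rep x y) (fun v => psi (z :: v)) w.
Proof. by rewrite /wact1 /= big_cat big_nseq_bool big_map. Qed.

Lemma eq_wact1 o psi psi' w : psi =1 psi' -> wact1 o psi w = wact1 o psi' w.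
Proof. by move=> e; apply: eq_bigr. Qed.

Lemma eq_wact B psi psi' : psi =1 psi' -> wact B psi =1 wact B psi'.
Proof. by move=> e; elim: B => //= o B IH w; apply: eq_wact1. Qed.

Lemma wact_cat B B' psi : wact (B ++ B') psi = wact B (wact B' psi).
Proof. by rewrite /wact foldr_cat. Qed.

Lemma wact1_sum o (I : Type) (r : seq I) (F : I -> seq T -> rat) w :
  wact1 o (fun v => \sum_(i <- r) F i v) w = \sum_(i <- r) wact1 o (F i) w.
Proof. exact: exchange_big. Qed.

Lemma wact_sum B (I : Type) (r : seq I) (F : I -> seq T -> rat) w :
  wact B (fun v => \sum_(i <- r) F i v) w = \sum_(i <- r) wact B (F i) w.
Proof.
by elim: B w => //= o B IH w; rewrite -wact1_sum; apply: eq_wact1 => v; apply: IH.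
Qed.

Lemma wact1D o psi psi' w :
  wact1 o (fun v => psi v + psi' v) w = wact1 o psi w + wact1 o psi' w.
Proof. exact: big_split. Qed.

Lemma wactD B psi psi' w :
  wact B (fun v => psi v + psi' v) w = wact B psi w + wact B psi' w.
Proof.
by elim: B w => //= o B IH w; rewrite -wact1D; apply: eq_wact1 => v; apply: IH.
Qed.

Lemma wact1Z o q psi w : wact1 o (fun v => q * psi v) w = q * wact1 o psi w.
Proof. by rewrite /wact1 mulr_sumr. Qed.

Lemma wactZ B q psi w : wact B (fun v => q * psi v) w = q * wact B psi w.
Proof.
by elim: B w => //= o B IH w; rewrite -wact1Z; apply: eq_wact1 => v; apply: IH.
Qed.

(** * Commutation of insertions with the other operators *)

Lemma ins_ins x y psi w :
  wact1 (Ins x) (wact1 (Ins y) psi) w = wact1 (Ins y) (wact1 (Ins x) psi) w.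
Proof.
elim: w psi => [|z w IH] psi.
  by rewrite !ins_nil !ins_cons !ins_nil addrC.
have E a b : wact1 (Ins a) (fun v => wact1 (Ins b) psi (z :: v)) w =
    wact1 (Ins a) (fun v => psi (b :: z :: v)) w +
    wact1 (Ins a) (wact1 (Ins b) (fun v => psi (z :: v))) w.
  by rewrite -wact1D; apply: eq_wact1 => v; rewrite ins_cons.
rewrite !ins_cons !E IH; ring.
Qed.

(** If the deleted letter is the inserted one, then [x = y] and each of the [(size w).+1] gaps gives
    back [w]. Otherwise inserting first offers one gap more, since the two gaps beside the deleted
    [y] merge after its deletion; the surplus is the replacement of [y] by [x]. *)
Lemma ins_del x y psi w :
  wact1 (Ins x) (wact1 (Del y) psi) w =
  wact1 (Del y) (wact1 (Ins x) psi) w + wact1 (Rep x y) psi w +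
  (x == y)%:R * (size w).+1%:R * psi w.
Proof.
elim: w psi => [|z w IH] psi.
  by rewrite ins_nil del_cons !del_nil rep_nil /= !addr0 add0r mulr1.
have E : wact1 (Ins x) (fun v => wact1 (Del y) psi (z :: v)) w =
    (z == y)%:R * wact1 (Ins x) psi w +
    wact1 (Ins x) (wact1 (Del y) (fun v => psi (z :: v))) w.
  by rewrite -wact1Z -wact1D; apply: eq_wact1 => v; rewrite del_cons.
have E' : wact1 (Del y) (fun v => wact1 (Ins x) psi (z :: v)) w =
    wact1 (Del y) (fun v => psi (x :: z :: v)) w +
    wact1 (Del y) (wact1 (Ins x) (fun v => psi (z :: v))) w.
  by rewrite -wact1D; apply: eq_wact1 => v; rewrite ins_cons.
rewrite ins_cons E IH !del_cons E' rep_cons /= -[in RHS]natr1; ring.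
Qed.

(** The two orders differ only when the replaced letter is the inserted one. *)
Lemma ins_rep x z y psi w :
  wact1 (Ins x) (wact1 (Rep z y) psi) w =
  wact1 (Rep z y) (wact1 (Ins x) psi) w + (x == y)%:R * wact1 (Ins z) psi w.
Proof.
elim: w psi => [|a w IH] psi.
  by rewrite !ins_nil rep_cons !rep_nil addr0 add0r.
have E : wact1 (Ins x) (fun v => wact1 (Rep z y) psi (a :: v)) w =
    (a == y)%:R * wact1 (Ins x) (fun v => psi (z :: v)) w +
    wact1 (Ins x) (wact1 (Rep z y) (fun v => psi (a :: v))) w.
  by rewrite -wact1Z -wact1D; apply: eq_wact1 => v; rewrite rep_cons.
have E' : wact1 (Rep z y) (fun v => wact1 (Ins x) psi (a :: v)) w =
    wact1 (Rep z y) (fun v => psi (x :: a :: v)) w +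
    wact1 (Rep z y) (wact1 (Ins x) (fun v => psi (a :: v))) w.
  by rewrite -wact1D; apply: eq_wact1 => v; rewrite ins_cons.
rewrite ins_cons E IH !rep_cons E' !ins_cons; ring.
Qed.

Definition shift1 (o : wop) : int :=
  match o with Ins _ => 1 | Del _ => -1 | Rep _ _ => 0 end.

Definition shift (B : seq wop) : int := \sum_(o <- B) shift1 o.

Lemma size_outs o w v : v \in outs o w -> (size v)%:Z = (size w)%:Z + shift1 o.
Proof.
case: o => [x|x|x y] /=; elim: w v => [|z w IH] v //=.
- by rewrite inE => /eqP->.
- rewrite inE => /orP[/eqP->|/mapP[u /IH Hu ->]] /=; lia.
- rewrite mem_cat => /orP[|/mapP[u /IH Hu ->]] /=; last lia.
  by rewrite mem_nseq => /andP[_ /eqP->]; lia.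
- rewrite mem_cat => /orP[|/mapP[u /IH Hu ->]] /=; last lia.
  by rewrite mem_nseq => /andP[_ /eqP->] /=; lia.
Qed.

Lemma eq_wact_size B psi psi' w :
  (forall v, (size v)%:Z = (size w)%:Z + shift B -> psi v = psi' v) ->
  wact B psi w = wact B psi' w.
Proof.
elim: B w => [|o B IH] w E /=.
  by apply: E; rewrite /shift big_nil addr0.
apply: eq_big_seq => v /size_outs Hv; apply: IH => u Hu; apply: E.
by rewrite Hu Hv /shift big_cons addrA.
Qed.

(** All words that [B] produces from [w] have the same length, so the length factor created by
    [ins_del] can be pulled out of the sum. *)
Lemma wact_sizeS B psi w :
  wact B (fun v => (size v).+1%:R * psi v) w =
  ((size w)%:R + ((shift B)%:~R + 1)) * wact B psi w.
Proof.
rewrite -wactZ; apply: eq_wact_size => v vE; congr (_ * _).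
by rewrite -natr1 addrA -[(size v)%:R]/((size v)%:Z%:~R) vE intrD.
Qed.

Lemma ins_outs_perm x w v : v \in ins_outs x w -> perm_eq v (x :: w).
Proof.
elim: w v => [|y w IH] v /=; first by rewrite inE => /eqP->.
rewrite inE => /orP[/eqP-> //|/mapP[u /IH Hu ->]].
rewrite (perm_trans (_ : perm_eq _ (y :: x :: w))) ?perm_cons //.
by rewrite (perm_catCA [:: y] [:: x]).
Qed.

Lemma del_outs_perm x w v : v \in del_outs x w -> perm_eq w (x :: v).
Proof.
elim: w v => [|y w IH] v //=; rewrite mem_cat => /orP[|/mapP[u /IH Hu ->]].
  by rewrite mem_nseq lt0b => /andP[/eqP-> /eqP->].
rewrite (perm_trans (_ : perm_eq _ (y :: x :: u))) ?perm_cons //.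
by rewrite (perm_catCA [:: y] [:: x]).
Qed.

Lemma rep_outs_perm x y w v :
  v \in rep_outs x y w -> exists2 u, perm_eq v (x :: u) & perm_eq w (y :: u).
Proof.
elim: w v => [|z w IH] v //=; rewrite mem_cat => /orP[|/mapP[u /IH Hu ->]].
  by rewrite mem_nseq lt0b => /andP[/eqP-> /eqP->]; exists w.
have [t ut wt] := Hu; exists (z :: t).
  rewrite (perm_trans (_ : perm_eq _ (z :: x :: t))) ?perm_cons //.
  by rewrite (perm_catCA [:: z] [:: x]).
rewrite (perm_trans (_ : perm_eq _ (z :: y :: t))) ?perm_cons //.
by rewrite (perm_catCA [:: z] [:: y]).
Qed.

Lemma size_ins_outs x w : size (ins_outs x w) = (size w).+1.
Proof. by elim: w => //= y w IH; rewrite size_map IH. Qed.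

Lemma size_del_outs x w : size (del_outs x w) = count_mem x w.
Proof. by elim: w => //= y w IH; rewrite size_cat size_nseq size_map IH. Qed.

Lemma size_rep_outs x y w : size (rep_outs x y w) = count_mem y w.
Proof. by elim: w => //= z w IH; rewrite size_cat size_nseq size_map IH. Qed.

(** * Operators on symmetric functions of words *)

Definition symmetric_fun psi := forall w v, perm_eq w v -> psi w = psi v.

Lemma sum_constant (r : seq (seq T)) psi q :
  (forall v, v \in r -> psi v = q) -> \sum_(v <- r) psi v = (size r)%:R * q.
Proof.
move=> E; rewrite (eq_big_seq (fun=> q) E) big_const_seq count_predT.
by rewrite iter_addr_0 mulr_natl.
Qed.

Section Symmetric.
Variables (psi : seq T -> rat) (psi_sym : symmetric_fun psi).

(** Here and in the next two lemmas, all outcomes of the operator are rearrangements of each other,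
    so only their number matters. *)
Lemma ins_sym x w : wact1 (Ins x) psi w = (size w).+1%:R * psi (x :: w).
Proof.
rewrite -(size_ins_outs x); apply: sum_constant => v Hv.
exact/psi_sym/ins_outs_perm.
Qed.

Lemma del_sym x w : wact1 (Del x) psi w = (count_mem x w)%:R * psi (rem x w).
Proof.
rewrite -(size_del_outs x); apply: sum_constant => v Hv; apply: psi_sym.
have wv := del_outs_perm Hv; rewrite -(perm_cons x) -(permPl wv).
by rewrite perm_to_rem // (perm_mem wv) mem_head.
Qed.

Lemma rep_sym x y w :
  wact1 (Rep x y) psi w = (count_mem y w)%:R * psi (x :: rem y w).
Proof.
rewrite -(size_rep_outs x); apply: sum_constant => v Hv; apply: psi_sym.
have [u vu wu] := rep_outs_perm Hv; rewrite (permPl vu) perm_cons.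
rewrite -(perm_cons y) -(permPl wu).
by rewrite perm_to_rem // (perm_mem wu) mem_head.
Qed.

Lemma wact1_sym o : symmetric_fun (wact1 o psi).
Proof.
move=> w v wv; have cwv x : count_mem x w = count_mem x v by move/seq.permP: wv => ->.
have rwv x : (0 < count_mem x v)%N -> perm_eq (rem x w) (rem x v).
  rewrite -has_count has_pred1 => xv; rewrite -(perm_cons x).
  rewrite -(permPl (perm_to_rem _)) ?(perm_mem wv) // (permPl wv).
  exact: perm_to_rem.
case: o => [x|x|x y].
- by rewrite !ins_sym (perm_size wv); congr (_ * _); apply: psi_sym; rewrite perm_cons.
- rewrite !del_sym cwv; case: (posnP (count_mem x v)) => [->|/rwv H].
    by rewrite !mul0r.
  by congr (_ * _); apply: psi_sym.
- rewrite !rep_sym cwv; case: (posnP (count_mem y v)) => [->|/rwv H].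
    by rewrite !mul0r.
  by congr (_ * _); apply: psi_sym; rewrite perm_cons.
Qed.

End Symmetric.

Lemma wact_sym B psi : symmetric_fun psi -> symmetric_fun (wact B psi).
Proof. by move=> H; elim: B => //= o B IH; apply: wact1_sym. Qed.

End WordOperators.

Arguments Ins {T}.
Arguments Del {T}.
Arguments Rep {T}.

(** * Twisted traces *)

(** The factor [n] makes the truncation of [n.-1] at [n = 0] harmless. *)
Lemma poly_from_mul_pred d f : poly_from d 0 f ->
  poly_from d.+1 0 (fun n => n%:R * f n.-1).
Proof.
move=> [p [sp pE]]; exists ('X * (p \Po ('X - 1%:P))); split=> [|n _].
  by rewrite (leq_trans (size_polyMleq _ _)) // size_polyX size_comp_poly2 ?size_XsubC.
rewrite hornerM hornerX horner_comp !hornerE.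
by case: n => [|n]; rewrite ?mul0r // pE //= -[n.+1%:R]natr1 addrK.
Qed.

Section TwistedTrace.

Variables (T : finType) (X : T) (tau : {perm T}).
(** Grades live in an arbitrary group, so that a product of two alphabets can keep both grades; [sz]
    turns a grade into an integer on which to induct. *)
Variables (M : zmodType) (gam : T -> M) (sz : M -> int).
Hypothesis tauX : tau X = X.
Hypothesis gamX : gam X = 0.
Hypothesis gam_tau : forall x, gam (tau x) = gam x.
Hypothesis szD : forall a b, sz (a + b) = sz a + sz b.
Hypothesis sz_gam : forall x, x != X -> 1 <= sz (gam x).

Definition grade (w : seq T) : M := \sum_(x <- w) gam x.

(** The diagonal sum of [B] followed by the inverse of [tau]: each word [w] contributes the number
    of ways in which [B] turns it into [map tau w]. *)
Definition tr (c : M) (B : seq (wop T)) (n : nat) : rat :=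
  \sum_(w : n.-tuple T | grade w == c)
    wact B (fun v => (v == map tau w)%:R) w.

Lemma sz0 : sz 0 = 0.
Proof. by have := szD 0 0; rewrite addr0; lia. Qed.

Lemma szB a b : sz (a - b) = sz a - sz b.
Proof. by have := szD (a - b) b; rewrite subrK; lia. Qed.

Lemma sz_gam_ge0 x : 0 <= sz (gam x).
Proof.
by have [->|/sz_gam] := eqVneq x X; [rewrite gamX sz0|lia].
Qed.

Lemma grade_cons x w : grade (x :: w) = gam x + grade w.
Proof. exact: big_cons. Qed.

Lemma sz_grade_ge0 w : 0 <= sz (grade w).
Proof.
elim: w => [|x w IH]; first by rewrite /grade big_nil sz0.
by rewrite grade_cons szD addr_ge0 ?sz_gam_ge0.
Qed.

Lemma sz_grade_le0 w : sz (grade w) <= 0 -> w = nseq (size w) X.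
Proof.
elim: w => //= x w IH; rewrite grade_cons szD => H.
have := sz_grade_ge0 w; have := sz_gam_ge0 x => Hx Hw.
rewrite -IH; last by lia.
by have [->//|/sz_gam] := eqVneq x X; lia.
Qed.

Lemma tr_neg c B n : sz c < 0 -> tr c B n = 0.
Proof.
move=> c0; rewrite /tr; apply: big_pred0 => w; apply/negbTE/eqP => wc.
by have := sz_grade_ge0 w; rewrite wc; lia.
Qed.

Lemma tr_shift c B n : shift B != 0 -> tr c B n = 0.
Proof.
move=> B0; apply: big1 => w _.
(* The zero function is written as [0 * 0] so that [wactZ] applies to it. *)
rewrite (@eq_wact_size _ B _ (fun=> 0 * 0)) => [|v vE].
  by rewrite wactZ mul0r.
rewrite mul0r; case: eqP => // E.
by move: vE; rewrite E size_map; lia.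
Qed.

Lemma tr_ext c B B' n :
  (forall psi, wact B psi =1 wact B' psi) -> tr c B n = tr c B' n.
Proof. by move=> E; rewrite /tr; apply: eq_bigr => w _; rewrite E. Qed.

Lemma tr_ins_ins c B1 x y B2 n :
  tr c (B1 ++ Ins x :: Ins y :: B2) n = tr c (B1 ++ Ins y :: Ins x :: B2) n.
Proof.
apply: tr_ext => psi w; rewrite !wact_cat; apply: eq_wact => v.
exact: ins_ins.
Qed.

Lemma tr_ins_del c B1 x y B2 n :
  tr c (B1 ++ Ins x :: Del y :: B2) n =
  tr c (B1 ++ Del y :: Ins x :: B2) n + tr c (B1 ++ Rep x y :: B2) n +
  (x == y)%:R * ((n%:R + ((shift B1)%:~R + 1)) * tr c (B1 ++ B2) n).
Proof.
rewrite /tr !mulr_sumr -!big_split; apply: eq_bigr => w _ /=.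
rewrite !wact_cat -[n in n%:R + _](size_tuple w) -wact_sizeS -wactZ -!wactD.
by apply: eq_wact => v; rewrite /= ins_del mulrA.
Qed.

Lemma tr_ins_rep c B1 x z y B2 n :
  tr c (B1 ++ Ins x :: Rep z y :: B2) n =
  tr c (B1 ++ Rep z y :: Ins x :: B2) n +
  (x == y)%:R * tr c (B1 ++ Ins z :: B2) n.
Proof.
rewrite /tr !mulr_sumr -!big_split; apply: eq_bigr => w _ /=.
rewrite !wact_cat -wactZ -!wactD.
by apply: eq_wact => v; rewrite /= ins_rep.
Qed.

(** A sum over all words of length [m] is inserted between the operator and [G], as in a matrix
    product; this is what allows the factors of a trace to be rotated. *)
Lemma wact1_tuple o (G : seq T -> rat) (v : seq T) m :
  m%:Z = (size v)%:Z + shift1 o ->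
  wact1 o G v = \sum_(w : m.-tuple T) wact1 o (fun u => (u == w)%:R) v * G w.
Proof.
move=> mE; under eq_bigr do rewrite /wact1 mulr_suml.
rewrite exchange_big; apply: eq_big_seq => u /size_outs uE /=.
have su : size u == m by rewrite -eqz_nat uE mE.
rewrite (bigD1 (Tuple su)) //= eqxx mul1r big1 ?addr0 // => w.
by rewrite -val_eqE /= eq_sym => /negbTE->; rewrite mul0r.
Qed.

Lemma ins_map x psi v :
  wact1 (Ins (tau x)) psi (map tau v) = wact1 (Ins x) (fun u => psi (map tau u)) v.
Proof.
elim: v psi => [|y v IH] psi; first by rewrite !ins_nil.
by rewrite /= !ins_cons IH.
Qed.

Lemma wact1_ins_size (x : T) (psi : seq T -> rat) (v : seq T) k :
  (forall u, size u = k.+1 -> psi u = 0) ->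
  size v = k -> wact1 (Ins x) psi v = 0.
Proof.
move=> H sv; apply: big1_seq => u /andP[_ /size_outs uE]; apply: H.
by move: uE; rewrite sv /=; lia.
Qed.

(** Cyclicity of the trace. Carrying the insertion past the twist changes [x] into its preimage
    under [tau]; the sum then runs over the words before that insertion, which are shorter by one
    and lack the grade of [x]. *)
Lemma tr_rotate c B x n : tr c (rcons B (Ins x)) n.+1 =
  tr (c - gam x) (Ins ((tau^-1)%g x) :: B) n.
Proof.
set x' := (tau^-1)%g x; have x'E : x = tau x' by rewrite permKV.
(* Inserting [x] into [map tau v'] gives [map tau w] exactly as often as inserting [x'] into [v']
   gives [w]. *)
have insE (w : n.+1.-tuple T) v :
    wact1 (Ins x) (fun u => (u == map tau w)%:R) v =
    \sum_(v' : n.-tuple T)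
      wact1 (Ins x') (fun u => (u == w)%:R) v' * (v == map tau v')%:R.
  have [sv|sv] := eqVneq (size v) n; last first.
    rewrite big1 => [|v' _]; last first.
      have [E|] := eqVneq v (map tau v'); last by rewrite mulr0.
      by rewrite E size_map size_tuple eqxx in sv.
    apply: wact1_ins_size (erefl _) => u su; case: eqP => // uE.
    by case/eqP: sv; apply: succn_inj; rewrite -su uE size_map size_tuple.
  pose v1 := map (tau^-1)%g v.
  have vE : v = map tau v1 by rewrite -map_comp map_id_in // => i _ /=; rewrite permKV.
  have sv1 : size v1 == n by rewrite size_map sv.
  rewrite (bigD1 (Tuple sv1)) //= -vE eqxx mulr1 big1 => [|v' Hv'].
    rewrite addr0 vE x'E ins_map; apply: eq_wact1 => u.
    by rewrite (inj_eq (inj_map perm_inj)).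
  rewrite vE (inj_eq (inj_map perm_inj)) -[v1]/(tval (Tuple sv1)) val_eqE.
  by rewrite eq_sym (negbTE Hv') mulr0.
rewrite /tr; transitivity (\sum_(w : n.+1.-tuple T | grade w == c)
    \sum_(v' : n.-tuple T) wact1 (Ins x') (fun u => (u == w)%:R) v' *
       wact B (fun v => (v == map tau v')%:R) w).
  apply: eq_bigr => w _; rewrite -cats1 wact_cat.
  under eq_bigr do rewrite -wactZ.
  by rewrite -wact_sum; apply: eq_wact => v; apply: insE.
rewrite big_mkcond [RHS]big_mkcond /=.
transitivity (\sum_(v' : n.-tuple T) \sum_(w : n.+1.-tuple T)
   (grade w == c)%:R * (wact1 (Ins x') (fun u => (u == w)%:R) v' *
       wact B (fun v => (v == map tau v')%:R) w)).
  rewrite exchange_big; apply: eq_bigr => w _; rewrite -mulr_sumr.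
  by case: ifP => _; rewrite ?mul1r ?mul0r.
apply: eq_bigr => v' _.
rewrite (@wact1_tuple _ _ _ n.+1) ?size_tuple ?intS ?[1 + _]addrC //.
(* A word [w] obtained from [v'] by inserting [x'] has the grade of [v'] plus that of [x], as [tau]
   preserves grades. *)
have E (w : n.+1.-tuple T) : (grade w == c)%:R *
    wact1 (Ins x') (fun u => (u == w)%:R) v' =
    (grade v' == c - gam x)%:R * wact1 (Ins x') (fun u => (u == w)%:R) v'.
  have [Hw|Hw] := boolP (val w \in ins_outs x' v'); last first.
    rewrite [wact1 _ _ _]big1_seq ?mulr0 // => u /andP[_ Hu].
    by case: eqP => // uw; case/negP: Hw; move: Hu; rewrite uw.
  congr ((nat_of_bool _)%:R * _); rewrite /grade (perm_big _ (ins_outs_perm Hw)) big_cons.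
  by rewrite x'E gam_tau [LHS]eq_sym [RHS]eq_sym subr_eq addrC.
under eq_bigr do rewrite mulrA E -mulrA.
by rewrite -mulr_sumr; case: ifP => _; rewrite ?mul1r ?mul0r.
Qed.

Lemma tr_ins0 c B x : tr c (rcons B (Ins x)) 0 = 0.
Proof.
rewrite /tr; apply: big1 => w _; rewrite tuple0 -cats1 wact_cat /=.
rewrite (@eq_wact _ _ _ (fun=> 0 * 0)) ?wactZ ?mul0r // => v.
apply: big1_seq => u /andP[_ /size_outs].
by case: u => //=; lia.
Qed.

(** * Words of blanks *)

Definition vac (w : seq T) : rat := (all (pred1 X) w)%:R.

Lemma vac_sym : symmetric_fun vac.
Proof. by move=> w v wv; rewrite /vac (perm_all _ wv). Qed.

(** By symmetry, an [x] that occurs in [u] may be removed from [u]. Otherwise only a blank of the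
    tail can be removed, and the factor [m] covers the case of an empty tail. *)
Lemma rem_poly (psi : seq T -> rat) x t u :
    symmetric_fun psi ->
    (forall u, exists d, poly_from d 0 (fun m => psi (u ++ nseq m X))) ->
  exists d, poly_from d 0 (fun m =>
    (count_mem x (u ++ nseq m X))%:R * psi (t ++ rem x (u ++ nseq m X))).
Proof.
move=> ps psi_poly; have [xu|xu] := boolP (x \in u).
  have [d Hd] := psi_poly (t ++ rem x u).
  have remE m : psi (t ++ rem x (u ++ nseq m X)) = psi ((t ++ rem x u) ++ nseq m X).
    apply: ps; rewrite -catA perm_cat2l -(perm_cons x) -cat_cons.
    rewrite perm_sym -(permPr (perm_to_rem _)) ?mem_cat ?xu //.
    by rewrite perm_cat2r perm_sym perm_to_rem.
  exists d.+1; have [xX|xX] := eqVneq x X.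
    apply: poly_from_ext (poly_fromM_linear (count_mem x u)%:R Hd) => m _.
    by rewrite remE count_cat count_nseq /= xX eqxx mul1n addrC natrD.
  have Hd' := poly_fromZ (count_mem x u)%:R Hd.
  apply: poly_from_ext (poly_from_mono (leqnSn d) (leqnn _) Hd') => m _.
  by rewrite remE count_cat count_nseq /= eq_sym (negbTE xX) mul0n addn0.
have cu : count_mem x u = 0%N by apply/count_memPn.
have [xX|xX] := eqVneq x X; last first.
  exists 0%N; apply: poly_from_ext (poly_from_const 0 0 0) => m _.
  by rewrite count_cat count_nseq /= cu eq_sym (negbTE xX) mul0r.
have [d Hd] := psi_poly (t ++ u); exists d.+1.
apply: poly_from_ext (poly_from_mul_pred Hd) => m _.
rewrite count_cat count_nseq /= cu xX eqxx mul1n add0n.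
case: m => [|m]; rewrite ?mul0r //=; congr (_ * _); apply: ps.
rewrite -catA perm_cat2l -(perm_cons X) -(permPr (perm_to_rem _)); last first.
  by rewrite mem_cat mem_head orbT.
by rewrite -[X :: nseq m X]cat1s perm_sym perm_catCA.
Qed.

(** By symmetry each operator only changes [u] or the number of blanks, with a multiplicity at most
    linear in [m]. *)
Lemma wact_vac_poly B u :
  exists d, poly_from d 0 (fun m => wact B vac (u ++ nseq m X)).
Proof.
elim: B u => [|o B IH] u.
  exists 0%N; apply: poly_from_ext (poly_from_const 0 0 (vac u)) => m _.
  by rewrite /= /vac all_cat all_nseq /= eqxx orbT andbT.
have ps : symmetric_fun (wact B vac) by apply/wact_sym/vac_sym.
case: o => [x|x|x y] /=.
- have [d Hd] := IH (x :: u); exists d.+1.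
  apply: poly_from_ext (poly_fromM_linear (size u).+1%:R Hd) => m _.
  by rewrite (ins_sym ps) size_cat size_nseq -natrD addnC addSn.
- have [d Hd] := rem_poly x [::] u ps IH; exists d.
  by apply: poly_from_ext Hd => m _; rewrite (del_sym ps).
- have [d Hd] := rem_poly y [:: x] u ps IH; exists d.
  by apply: poly_from_ext Hd => m _; rewrite (rep_sym ps).
Qed.

(* The factor [n.+1] makes this polynomial vanish at [n = -1]; in [tr_poly] this
   extends the range of validity to [n = 0] when [sz c = 1]. *)
Lemma tr_ins_vacuum c x B : sz c <= 0 -> exists d k,
  poly_from d 0 k /\ forall n, tr c (Ins x :: B) n = n.+1%:R * k n.
Proof.
move=> c0; have zero : (forall n, tr c (Ins x :: B) n = 0) -> exists d k,
    poly_from d 0 k /\ forall n, tr c (Ins x :: B) n = n.+1%:R * k n.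
  move=> H; exists 0%N, (fun=> 0); split; first exact: poly_from_const.
  by move=> n; rewrite H mulr0.
have [S0|] := eqVneq (shift (Ins x :: B)) 0; last first.
  by move=> S0; apply: zero => n; apply: tr_shift.
have grX n : grade (nseq n X) = 0.
  by elim: n => [|n IH]; rewrite ?grade_cons ?gamX ?IH ?addr0 // /grade big_nil.
have [c_eq0|c_neq0] := eqVneq c 0; last first.
  apply: zero => n; rewrite /tr; apply: big_pred0 => w.
  apply/negbTE; apply: contraNneq c_neq0 => wc.
  by rewrite -wc (sz_grade_le0 (w := w)) ?grX ?wc.
have [d Hd] := wact_vac_poly B [:: x].
exists d, (fun m => wact B vac ([:: x] ++ nseq m X)); split=> // n.
rewrite /tr c_eq0 (bigD1 [tuple of nseq n X]) /=; last by rewrite grX.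
rewrite big1 ?addr0 => [|w /andP[/eqP w0 wX]]; last first.
  case/eqP: wX; apply: val_inj; rewrite /= (sz_grade_le0 (w := w)) ?w0 ?sz0 //.
  by rewrite size_tuple.
rewrite -[X in X%:R * _](size_nseq n.+1 X) /= -(ins_sym (wact_sym _ vac_sym)).
have := @eq_wact_size _ (Ins x :: B) _ vac (nseq n X); apply => v.
rewrite S0 addr0 size_nseq => -[vn]; rewrite /vac.
rewrite map_nseq tauX -{1}vn; congr (nat_of_bool _)%:R.
by apply/eqP/all_pred1P.
Qed.

(** Each commutation leaves products with one operator fewer, or with two fewer and a factor linear
    in [n]. So the difference has a degree bound one below that expected for the product itself. *)
Lemma tr_move_ins c k m B1 x B2 :
  (forall B, (size B <= size B1 + size B2)%N ->
     poly_from (k + size B) m (tr c B)) ->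
  poly_from (k + size B1 + size B2) m
    (fun n => tr c (B1 ++ Ins x :: B2) n - tr c (rcons (B1 ++ B2) (Ins x)) n).
Proof.
elim: B2 B1 => [|o B2 IH] B1 H.
  apply: poly_from_ext (poly_from_const _ _ 0) => n _.
  by rewrite cats0 cats1 subrr.
have H1 B : (size B <= size B1 + (size B2).+1)%N ->
    poly_from (k + size B1 + (size B2).+1) m (tr c B).
  by move=> sB; apply: poly_from_mono (H B sB) => //=; lia.
have {IH} : poly_from (k + size B1 + (size B2).+1) m (fun n =>
    tr c (B1 ++ o :: Ins x :: B2) n - tr c (rcons (B1 ++ o :: B2) (Ins x)) n).
  have := IH (rcons B1 o); rewrite !cat_rcons size_rcons addSnnS.
  rewrite -[X in poly_from X]addnA addSnnS addnA.
  by apply=> B sB; apply: H => /=; lia.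
have tail F : poly_from (k + size B1 + (size B2).+1) m F ->
    (forall n, tr c (B1 ++ [:: Ins x, o & B2]) n =
               tr c (B1 ++ [:: o, Ins x & B2]) n + F n) ->
    poly_from (k + size B1 + (size B2).+1) m (fun n =>
      tr c (B1 ++ o :: Ins x :: B2) n - tr c (rcons (B1 ++ o :: B2) (Ins x)) n) ->
    poly_from (k + size B1 + size (o :: B2)) m (fun n =>
      tr c (B1 ++ Ins x :: o :: B2) n - tr c (rcons (B1 ++ o :: B2) (Ins x)) n).
  move=> HF E HI; apply: poly_from_ext (poly_fromD HI HF) => n _.
  by rewrite E addrAC.
case: o H tail => [y|y|z y] H tail.
- apply: (tail (fun=> 0)); first exact: poly_from_const.
  by move=> n; rewrite addr0 tr_ins_ins.
- apply: (tail (fun n => tr c (B1 ++ Rep x y :: B2) n + (x == y)%:R *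
    ((n%:R + ((shift B1)%:~R + 1)) * tr c (B1 ++ B2) n))).
    apply: poly_fromD; first by apply: H1; rewrite size_cat.
    apply: poly_fromZ; rewrite addnS; apply: poly_fromM_linear.
    by rewrite -addnA -size_cat; apply: H; rewrite size_cat /=; lia.
  by move=> n; rewrite tr_ins_del -!addrA.
- apply: (tail (fun n => (x == y)%:R * tr c (B1 ++ Ins z :: B2) n)).
    by apply: poly_fromZ; apply: H1; rewrite size_cat.
  by move=> n; rewrite tr_ins_rep.
Qed.

(** * Removing the first letter of a word *)

Fixpoint rep_letter (A : seq (wop T)) (z : T) : option T :=
  if A is Rep x y :: A' then if z == y then rep_letter A' x else None
  else if A is [::] then Some z else None.

(** Each pair says which operators act on the first letter and which on the rest; [rep_letter]
    follows the first letter through its share and fails when a replacement does not match. *)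
Fixpoint splits (A : seq (wop T)) : seq (seq (wop T) * seq (wop T)) :=
  if A is o :: A' then
    [seq (o :: p.1, p.2) | p <- splits A'] ++
    [seq (p.1, o :: p.2) | p <- splits A']
  else [:: ([::], [::])].

Definition is_ins (o : wop T) := if o is Ins _ then true else false.
Definition is_rep (o : wop T) := if o is Rep _ _ then true else false.

Lemma wact_splits B psi z w : all is_rep B -> wact B psi (z :: w) =
  \sum_(p <- splits B)
    (if rep_letter p.1 z is Some z' then wact p.2 (fun v => psi (z' :: v)) w
     else 0).
Proof.
elim: B z w => [|[x|x|x y] B IH] z w //=; first by rewrite big_seq1.
move=> rB; rewrite rep_cons big_cat !big_map /=; congr (_ + _).
  by case: (z == y); rewrite ?mul1r ?IH // mul0r big1.
transitivity (wact1 (Rep x y) (fun v => \sum_(p <- splits B)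
    (if rep_letter p.1 z is Some z' then wact p.2 (fun v => psi (z' :: v)) v
     else 0)) w); first by apply: eq_wact1 => v; rewrite IH.
rewrite wact1_sum; apply: eq_bigr => p _.
by case: rep_letter => //; apply: big1.
Qed.

(** Only one split leaves all of [B] to the rest of the word; it is singled out because it
    reproduces the trace itself in the recursion. *)
Lemma splits_size B : exists2 s, splits B = rcons s ([::], B) &
  all (fun p => size p.2 < size B)%N s.
Proof.
elim: B => [|o B [s sE Hs]] /=; first by exists [::].
exists ([seq (o :: p.1, p.2) | p <- rcons s ([::], B)] ++
        [seq (p.1, o :: p.2) | p <- s]).
  by rewrite sE !map_rcons rcons_cat.
rewrite all_cat !all_map all_rcons /= ltnS leqnn /=; apply/andP; split.
  by apply: sub_all Hs => p /=; exact: ltnW.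
by apply: sub_all Hs.
Qed.

Lemma sum_tuple_cons n (F : seq T -> rat) (P : pred (seq T)) :
  \sum_(w : n.+1.-tuple T | P w) F w =
  \sum_z \sum_(w : n.-tuple T | P (z :: w)) F (z :: w).
Proof.
rewrite pair_big_dep /=.
rewrite (reindex (fun p : T * n.-tuple T => [tuple of p.1 :: p.2])) //=.
exists (fun w : n.+1.-tuple T => (thead w, [tuple of behead w])) => w _ /=.
  by case: w => z w; congr pair; apply: val_inj.
by rewrite -tuple_eta.
Qed.

Lemma tr_first_letter c B n : all is_rep B -> tr c B n.+1 =
  \sum_z \sum_(p <- splits B)
    (rep_letter p.1 z == Some (tau z))%:R * tr (c - gam z) p.2 n.
Proof.
move=> rB; rewrite /tr (@sum_tuple_cons _
  (fun w => wact B (fun v => (v == map tau w)%:R) w) (fun w => grade w == c)).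
apply: eq_bigr => z _.
under [RHS]eq_bigr do rewrite mulr_sumr.
rewrite exchange_big; apply: eq_big => [w|w _] /=.
  by rewrite grade_cons addrC [RHS]eq_sym subr_eq eq_sym.
rewrite wact_splits //; apply: eq_bigr => p _.
case: rep_letter => [z'|]; last by rewrite mul0r.
rewrite -wactZ; apply: eq_wact => v; rewrite eqseq_cons.
rewrite (inj_eq (@Some_inj _)).
by case: eqP; rewrite ?mul1r ?mul0r.
Qed.

Lemma first_ins (B : seq (wop T)) :
  (exists B1 x B2, B = B1 ++ Ins x :: B2) \/ all (predC is_ins) B.
Proof.
elim: B => [|o B [[B1 [x [B2 ->]]]|IH]]; first by right.
  by left; exists (o :: B1), x, B2.
by case: o => [x|x|x y]; [left; exists [::], x, B | right | right].
Qed.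

(** Deletions cannot be compensated without insertions, so a product without insertions has trace
    zero or consists of replacements. *)
Lemma shift_no_ins (B : seq (wop T)) : all (predC is_ins) B ->
  shift B <= 0 /\ (shift B = 0 -> all is_rep B).
Proof.
elim: B => [|o B IH] /=; first by rewrite /shift big_nil.
move=> /andP[o_ins /IH[S0 HS]]; rewrite /shift big_cons -/(shift B).
by case: o o_ins => //= *; split; rewrite ?add0r //; lia.
Qed.

(** A nonblank first letter would leave a grade of negative size, so only blanks can be added. *)
Lemma tr_nil_const c n : sz c <= 0 -> tr c [::] n = tr c [::] 0.
Proof.
move=> c0; elim: n => // n <-; rewrite tr_first_letter // (bigD1 X) //=.
rewrite big_seq1 tauX eqxx mul1r gamX subr0 big1 ?addr0 // => z zX.
rewrite big_seq1 tr_neg ?mulr0 // szB.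
by have := sz_gam zX; lia.
Qed.

(** Induction on [k + size B]: every reduction either shortens the product or lowers the size of the
    grade. *)
Lemma tr_poly k c B : sz c <= k%:Z ->
  poly_from (k + size B) k.-1 (tr c B).
Proof.
have [N] := ubnP (k + size B); elim: N => // N IH in k c B * => sB ck.
have IHlt c' B' x : x != X -> sz c' <= k%:Z - sz (gam x) ->
    (size B' <= size B)%N ->
    poly_from (k + size B).-1 k.-2 (tr c' B').
  move=> xX c'k sB'; have x1 := sz_gam xX.
  have [c'0|c'0] := ltP (sz c') 0.
    by apply: poly_from_ext (poly_from_const _ _ 0) => n _; rewrite tr_neg.
  apply: (poly_from_mono (d := (k.-1 + size B')%N) (m := k.-2)); try lia.
  by apply: IH; lia.
have IHs B' : (size B' < size B)%N -> poly_from (k + size B') k.-1 (tr c B').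
  by move=> sB'; apply: IH => //; lia.
case: (first_ins B) => [[B1 [x [B2 BE]]]|Bins].
  have sizeB : size B = (size B1 + size B2).+1 by rewrite BE size_cat /= addnS.
  have Hmove y B1' B2' : (size B1' + size B2' = size B1 + size B2)%N ->
     poly_from (k + size B).-1 k.-1 (fun n => tr c (B1' ++ Ins y :: B2') n -
        tr c (rcons (B1' ++ B2') (Ins y)) n).
    move=> sB'; rewrite sizeB addnS /= -sB' addnA; apply: tr_move_ins => B' HB'.
    by apply: IHs; lia.
  set B' := B1 ++ B2.
  have sB' : size B' = (size B1 + size B2)%N by rewrite size_cat.
  suff H : poly_from (k + size B) k.-1 (tr c (rcons B' (Ins x))).
    have := Hmove x B1 B2 erefl; rewrite -BE -/B' => HB.
    have {}HB := poly_from_mono (leq_pred _) (leqnn _) HB.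
    by apply: poly_from_ext (poly_fromD HB H) => n _; rewrite subrK.
  have [xX|xX] := eqVneq x X.
    (* Rotating a blank lowers [n] by one and keeps the grade, so moving it back to the end yields a
       difference equation for the trace. *)
    rewrite (_ : k + size B = (k + size B).-1.+1)%N; last by lia.
    have := Hmove X [::] B'; rewrite sB' => /(_ erefl).
    apply: poly_from_antidiff => n kn.
    by rewrite xX tr_rotate [(tau^-1)%g X](_ : _ = X) ?gamX ?subr0 // -{1}tauX permK.
  set x' := (tau^-1)%g x; set c' := c - gam x.
  have c'k : sz c' <= k%:Z - sz (gam x) by rewrite szB; lia.
  (* Rotating any other letter lowers the grade, and [n] by one. The range then starts at [k.-2.+1],
     which is [k.-1] unless [k <= 1]. *)
  have Hs : poly_from (k + size B) k.-2.+1 (tr c (rcons B' (Ins x))).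
    apply: (poly_from_mono (d := (k + size B).-1%N) (m := k.-2.+1)); try lia.
    apply: (@poly_from_shift _ _ _ (tr c' (Ins x' :: B'))) => [n|].
      exact: tr_rotate.
    by apply: IHlt c'k _ => //=; lia.
  case: (ltnP 1 k) => k1; first by apply: poly_from_mono Hs => //; lia.
  (* For [k <= 1] the value at [n = 0] remains. There the trace is zero, and so is the polynomial
     obtained from [tr_ins_vacuum]. *)
  have c'0 : sz c' <= 0 by have := sz_gam xX; lia.
  have [d [h [Hh hE]]] := tr_ins_vacuum x' B' c'0.
  have H0 : poly_from d.+1 0 (tr c (rcons B' (Ins x))).
    apply: poly_from_ext (poly_from_mul_pred Hh) => -[|n] _.
      by rewrite tr_ins0 mul0r.
    by rewrite tr_rotate hE.
  by rewrite (_ : k.-1 = 0%N); [exact: poly_from_extend Hs H0 | lia].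
have [S0 HS] := shift_no_ins Bins.
have [/HS rB|Sn] := eqVneq (shift B) 0; last first.
  by apply: poly_from_ext (poly_from_const _ _ 0) => n _; rewrite tr_shift.
have [k0|k0] := posnP (k + size B).
  have B0 : B = [::] by apply/nilP; rewrite /nilp; lia.
  apply: poly_from_ext (poly_from_const _ _ (tr c B 0)) => n _.
  by rewrite B0 (tr_nil_const n) //; lia.
rewrite -(prednK k0); have [s sE Hs'] := splits_size B.
(* With a blank first letter and all of [B] acting on the rest, the term is the trace at [n]. The
   other terms, collected in [g], have fewer operators or a smaller grade. *)
pose g n := \sum_(p <- s)
    (rep_letter p.1 X == Some (tau X))%:R * tr c p.2 n +
  \sum_(z | z != X) \sum_(p <- splits B)
    (rep_letter p.1 z == Some (tau z))%:R * tr (c - gam z) p.2 n.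
apply: (@poly_from_antidiff _ _ _ g) => [n _|].
  rewrite tr_first_letter // (bigD1 X) //= {1}sE big_rcons /= tauX eqxx mul1r.
  rewrite gamX subr0 /g tauX; ring.
apply: poly_fromD.
  apply: poly_from_sum_all Hs' _ => p Hp; apply: poly_fromZ.
  by apply: poly_from_mono (IHs p.2 Hp) => //; lia.
apply: poly_from_sum => z zX.
apply: (@poly_from_sum_all _ _ _ _ (fun p => (size p.2 <= size B)%N)).
  by rewrite sE all_rcons leqnn; apply: sub_all Hs' => p; exact: ltnW.
move=> p Hp; apply: poly_fromZ.
apply: (poly_from_mono (d := (k + size B).-1%N) (m := k.-2)); try lia.
by apply: (IHlt _ _ z) => //; rewrite szB; lia.
Qed.

End TwistedTrace.

(** * Deletion followed by reinsertion *)

Section DeleteInsert.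

Variable T : finType.
Implicit Types (psi : seq T -> rat).

Definition word n (f : 'I_n -> T) : seq T := [seq f i | i <- enum 'I_n].

Lemma eq_word n (f g : 'I_n -> T) : f =1 g -> word f = word g.
Proof. by move=> fg; apply: eq_map. Qed.

Lemma word0 (f : 'I_0 -> T) : word f = [::].
Proof. by rewrite /word (size0nil (_ : size (enum 'I_0) = 0%N)) ?size_enum_ord. Qed.

Lemma wordS n (f : 'I_n.+1 -> T) :
  word f = f ord0 :: word (fun i => f (lift ord0 i)).
Proof. by rewrite /word enum_ordSl /= -map_comp. Qed.

Lemma word_tnth n (w : n.-tuple T) : word (tnth w) = w.
Proof. exact: map_tnth_enum. Qed.

Definition insf n (q : 'I_n.+1) (x : T) (f : 'I_n -> T) (i : 'I_n.+1) : T :=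
  if unlift q i is Some k then f k else x.

Lemma ins_word x psi n (f : 'I_n -> T) :
  wact1 (Ins x) psi (word f) = \sum_(q : 'I_n.+1) psi (word (insf q x f)).
Proof.
elim: n psi f => [|n IH] psi f.
  by rewrite word0 ins_nil big_ord1 wordS word0 /insf unlift_none.
rewrite [word f]wordS ins_cons IH [RHS]big_ord_recl; congr (_ + _).
  rewrite wordS {1}/insf unlift_none -wordS; congr (psi (x :: _)).
  by apply: eq_word => i; rewrite /insf liftK.
apply: eq_bigr => q _; rewrite [in RHS]wordS; congr (psi (_ :: _)).
  rewrite /insf; case: unliftP => [k|] /= kE.
    congr f; apply: val_inj; move: (congr1 val kE) => /=.
    by rewrite /bump /=; case: k kE => -[|k] //= kn _; lia.
  by move: (congr1 val kE).
apply: eq_word => i; rewrite /insf.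
case: unliftP => [k ->|->].
  rewrite (_ : lift ord0 (lift q k) = lift (lift ord0 q) (lift ord0 k)).
    by rewrite liftK.
  by apply: val_inj; rewrite /= /bump /=; lia.
by rewrite unlift_none.
Qed.

Lemma sum_del_word (F : T -> seq T -> rat) n (f : 'I_n.+1 -> T) :
  \sum_x wact1 (Del x) (F x) (word f) =
  \sum_p F (f p) (word (fun i => f (lift p i))).
Proof.
have first (g : T -> rat) y : \sum_x (y == x)%:R * g x = g y.
  rewrite (bigD1 y) //= eqxx mul1r big1 ?addr0 // => x.
  by rewrite eq_sym => /negbTE->; rewrite mul0r.
elim: n F f => [|n IH] F f.
  rewrite wordS word0 big_ord1 word0.
  by under eq_bigr do rewrite del_cons del_nil addr0; rewrite first.
rewrite wordS; under eq_bigr do rewrite del_cons.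
rewrite big_split /= (first (fun x => F x _)) [RHS]big_ord_recl; congr (_ + _).
rewrite (IH (fun x v => F x (f ord0 :: v))); apply: eq_bigr => p _.
congr F; rewrite [RHS]wordS; congr (f _ :: _).
  by apply: val_inj; rewrite /= /bump.
apply: eq_word => i; congr f; apply: val_inj; rewrite /= /bump /=; lia.
Qed.

(** The letter deleted first is reinserted last, so that one more step encloses the previous
    ones. *)
Fixpoint delins (j : nat) psi (w : seq T) : rat :=
  if j is j'.+1 then
    \sum_x wact1 (Del x) (delins j' (wact1 (Ins x) psi)) w
  else psi w.

End DeleteInsert.

(** * Increasing subsequences when a point is added to a permutation *)

Section IncreasingSubsequences.

Definition num_id_avoiding n k (q : 'I_n.+1) (s : 'S_n.+1) : nat :=
  #|[set t : k.-tuple 'I_n.+1 |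
      (q \notin t) && (sorted ltn [seq val i | i <- t] &&
                       sorted ltn [seq val (s i) | i <- t])]|.

(** [lift_perm q p s] adds the position [q] with value [p] to [s] and keeps the relative order of
    all other positions and values. *)
Lemma num_id_lift n k (q p : 'I_n.+1) (s : 'S_n) :
  num_id k s = num_id_avoiding k q (lift_perm q p s).
Proof.
have ltn_lift m (h : 'I_m.+1) (i j : 'I_m) : (lift h i < lift h j)%N = (i < j)%N.
  by rewrite /= /bump; lia.
have inj : injective (fun t : k.-tuple 'I_n => map_tuple (lift q) t).
  move=> t u /(congr1 val) /= /(inj_map lift_inj); exact: val_inj.
rewrite /num_id -(card_imset _ inj) /num_id_avoiding; apply: eq_card => t.
have sortedE (u : seq 'I_n) :
    sorted ltn [seq val i | i <- map (lift q) u] &&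
    sorted ltn [seq val (lift_perm q p s i) | i <- map (lift q) u] =
    sorted ltn [seq val i | i <- u] && sorted ltn [seq val (s i) | i <- u].
  rewrite -!map_comp !sorted_map; congr (_ && _); apply: eq_sorted => i j /=.
    exact: ltn_lift.
  by rewrite !lift_perm_lift; apply: ltn_lift.
apply/imsetP/idP => [[u]|].
  rewrite !inE => Hu ->; rewrite sortedE Hu andbT.
  by apply/mapP => -[i _ /eqP]; rewrite (negbTE (neq_lift _ _)).
rewrite inE => /andP[qt Ht].
have nq (i : 'I_k) : q != tnth t i.
  by apply: contraNneq qt => ->; apply: mem_tnth.
pose u := [tuple s2val (unlift_some (nq i)) | i < k].
have tu : t = map_tuple (lift q) u.
  apply: eq_from_tnth => i; rewrite tnth_map tnth_mktuple.
  by case: unlift_some.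
by exists u => //; rewrite inE -sortedE; move: Ht; rewrite tu.
Qed.

(** Double counting: a subsequence of length [k] avoids the [n.+1 - k] other positions. *)
Lemma sum_num_id_avoiding n k (s : 'S_n.+1) :
  (\sum_q num_id_avoiding k q s = (n.+1 - k) * num_id k s)%N.
Proof.
rewrite /num_id mulnC -sum_nat_const.
under eq_bigr do rewrite /num_id_avoiding -sum1_card.
rewrite (exchange_big_dep (mem [set t : k.-tuple 'I_n.+1 |
   sorted ltn [seq val i | i <- t] & sorted ltn [seq val (s i) | i <- t]])) /=.
  apply: eq_bigr => t; rewrite inE => /andP[t1 t2].
  rewrite sum1dep_card -[n.+1 in RHS]card_ord -[X in (_ - X)%N](size_tuple t).
  have /card_uniqP <- : uniq t.
    by apply: (@map_uniq _ _ val); apply: sorted_uniq t1; [exact: ltn_trans | exact: ltnn].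
  rewrite -(cardC (mem t)) addKn; apply: eq_card => q.
  rewrite !inE. by rewrite t1 t2 /= andbT.
move=> q t _; rewrite !inE. by case/andP.
Qed.

Lemma increasing_ord_tuple n (t : n.-tuple 'I_n) :
  sorted ltn [seq val i | i <- t] = (t == ord_tuple n).
Proof.
apply/idP/eqP => [t_lt|->]; last by rewrite /= val_enum_ord iota_ltn_sorted.
apply: val_inj; apply: (inj_map val_inj); rewrite /= val_enum_ord.
apply: irr_sorted_eq (t_lt) (iota_ltn_sorted 0 n) _ => [|i|i].
- exact: ltn_trans.
- exact: ltnn.
rewrite mem_iota /= add0n; apply/mapP/idP => [[k _ ->] //|i_n].
exists (Ordinal i_n) => //.
suff -> : t =i 'I_n by [].
apply/subset_cardP; last exact/subsetP.
rewrite card_ord -[RHS](size_tuple t); apply/card_uniqP.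
apply: (@map_uniq _ _ val); apply: sorted_uniq t_lt; [exact: ltn_trans|exact: ltnn].
Qed.

Lemma num_id_full n (s : 'S_n) : num_id n s = (s == 1%g).
Proof.
rewrite /num_id; under eq_finset do rewrite increasing_ord_tuple.
have sE : sorted ltn [seq val (s i) | i <- ord_tuple n] = (s == 1%g).
  rewrite (map_comp val s) -[map s _]/(val (map_tuple s (ord_tuple n))).
  rewrite increasing_ord_tuple; apply/eqP/eqP => [E|->].
    apply/permP => i; have := congr1 (fun t => tnth t i) E.
    by rewrite tnth_map tnth_ord_tuple perm1.
  by apply: eq_from_tnth => i; rewrite tnth_map tnth_ord_tuple perm1.
case: eqP sE => s1 sE.
  transitivity #|[set ord_tuple n]|; last by rewrite cards1.
  apply: eq_card => t; rewrite !inE.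
  by case: eqP => // ->; rewrite sE.
by apply: eq_card0 => t; rewrite !inE; case: eqP => // ->; rewrite sE.
Qed.

Lemma reindex_lift_perm n (q : 'I_n.+1) (G : 'S_n.+1 -> rat) :
  \sum_(p : 'I_n.+1) \sum_(s : 'S_n) G (lift_perm q p s) = \sum_s G s.
Proof.
rewrite pair_bigA /= (reindex (fun u : 'I_n.+1 * 'S_n => lift_perm q u.1 u.2)) //=.
have inj : injective (fun u : 'I_n.+1 * 'S_n => lift_perm q u.1 u.2).
  move=> [p s] [p' s'] /permP /= E.
  have pp : p = p' by have := E q; rewrite !lift_perm_id.
  subst p'; congr (_, _); apply/permP => i.
  by have := E (lift q i); rewrite !lift_perm_lift => /lift_inj.
apply: onW_bij; apply: inj_card_bij => //.
by rewrite card_prod card_ord !card_Sn factS.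
Qed.

End IncreasingSubsequences.

(** Deleting position [p] and reinserting its letter at [q] turns a permutation [s] of the remaining
    letters into [lift_perm q p s]. For fixed [q] these are all permutations, and the sum over [q]
    supplies the factor [j.+1] of the factorial. *)
Lemma delins_perm (T : finType) n j (psi : seq T -> rat) (f : 'I_n -> T) :
  (j <= n)%N -> delins j psi (word f) = j`!%:R *
    \sum_(s : 'S_n) (num_id (n - j) s)%:R * psi (word (fun i => f (s i))).
Proof.
elim: j n psi f => [|j IH] n psi f jn.
  rewrite /= subn0 mul1r (bigD1 1%g) //= big1 => [|s s1].
    rewrite addr0 num_id_full eqxx mul1r.
    by congr psi; apply: eq_word => i; rewrite perm1.
  by rewrite num_id_full (negbTE s1) mul0r.
case: n f jn => // n f jn; rewrite subSS /= sum_del_word.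
transitivity (\sum_p j`!%:R * \sum_(s : 'S_n) \sum_q
   (num_id_avoiding (n - j) q (lift_perm q p s))%:R *
   psi (word (fun i => f (lift_perm q p s i)))).
  apply: eq_bigr => p _; rewrite IH //; congr (_ * _); apply: eq_bigr => s _.
  rewrite ins_word mulr_sumr; apply: eq_bigr => q _.
  rewrite -num_id_lift; congr (_ * psi _); apply: eq_word => i; rewrite /insf.
  case: unliftP => [k ->|->]; first by rewrite lift_perm_lift.
  by rewrite lift_perm_id.
rewrite -mulr_sumr; under eq_bigr do rewrite exchange_big.
rewrite exchange_big /=.
under eq_bigr do rewrite (reindex_lift_perm _ (fun s =>
   (num_id_avoiding (n - j) _ s)%:R * psi (word (fun i => f (s i))))).
rewrite exchange_big /= factS mulnC natrM -mulrA; congr (_ * _).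
rewrite mulr_sumr; apply: eq_bigr => s _.
rewrite -mulr_suml -natr_sum sum_num_id_avoiding natrM mulrA; congr (_%:R * _ * _).
lia.
Qed.

(** * Class functions that are twisted traces *)

Definition class_family := forall n : nat, 'S_n -> rat.

Definition poly_counting (e : nat) (f : class_family) : Prop :=
  forall j, poly_from (e + 2 * j) (maxn j e.-1)
    (fun n => \sum_(s : 'S_n) f n s * (num_id (n - j) s)%:R).

(** The alphabet and its grading are part of the data, since a product of two such functions lives
    over the product alphabet. *)
Definition tracial (a : nat) (f : class_family) : Prop :=
  exists (T : finType) (X : T) (tau : {perm T}) (M : zmodType)
         (gam : T -> M) (sz : M -> int) (c : M),
    [/\ tau X = X, gam X = 0, forall x, gam (tau x) = gam x,
        forall a b, sz (a + b) = sz a + sz b &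
        forall x, x != X -> 1 <= sz (gam x)] /\
    sz c = a%:Z /\
    forall n (s : 'S_n), f n s =
      #|[set w : n.-tuple T | (grade gam w == c) &&
          [forall i, tnth w (s i) == tau (tnth w i)]]|%:R.

Section DeleteInsertTrace.

Variables (T : finType) (X : T) (tau : {perm T}).
Variables (M : zmodType) (gam : T -> M) (sz : M -> int).
Hypothesis tauX : tau X = X.
Hypothesis gamX : gam X = 0.
Hypothesis gam_tau : forall x, gam (tau x) = gam x.
Hypothesis szD : forall a b, sz (a + b) = sz a + sz b.
Hypothesis sz_gam : forall x, x != X -> 1 <= sz (gam x).

(** The outer operators [B1] and [B2] make the induction on [j] possible: each deletion with its
    reinsertion moves into them and adds 2 to their total length. *)
Lemma delins_poly k c j B1 B2 : sz c <= k%:Z ->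
  poly_from (k + size B1 + size B2 + 2 * j) k.-1 (fun n =>
    \sum_(w : n.-tuple T | grade gam w == c)
      wact B1 (delins j (wact B2 (fun v => (v == map tau w)%:R))) w).
Proof.
move=> ck; elim: j B1 B2 => [|j IH] B1 B2.
  have := tr_poly tauX gamX gam_tau szD sz_gam (B1 ++ B2) ck.
  rewrite size_cat muln0 addn0 addnA; apply: poly_from_ext => n _.
  by apply: eq_bigr => w _; rewrite wact_cat.
apply: poly_from_ext (_ : poly_from _ _ (fun n => \sum_x
    \sum_(w : n.-tuple T | grade gam w == c)
      wact (rcons B1 (Del x)) (delins j (wact (Ins x :: B2)
        (fun v => (v == map tau w)%:R))) w)) => [n _|].
  rewrite exchange_big; apply: eq_bigr => w _.
  by rewrite /= wact_sum; apply: eq_bigr => x _; rewrite -cats1 wact_cat.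
apply: poly_from_sum => x _.
apply: poly_from_mono (IH (rcons B1 (Del x)) (Ins x :: B2)) => //.
by rewrite size_rcons /=; lia.
Qed.

End DeleteInsertTrace.

Lemma tracial_poly a f : tracial a f -> poly_counting a f.
Proof.
case=> [T [X [tau [M [gam [sz [c [[tauX gamX gam_tau szD sz_gam] [cE fE]]]]]]]]] j.
have ck : sz c <= a%:Z by rewrite cE.
have := poly_fromZ (j`!%:R^-1)
  (delins_poly tauX gamX gam_tau szD sz_gam j [::] [::] ck).
rewrite /= !addn0 => /(poly_from_mono (leqnn _) (leq_maxr j a.-1)).
apply: poly_from_ext => n jn.
have {}jn : (j <= n)%N by apply: leq_trans jn; apply: leq_maxl.
rewrite mulr_sumr.
transitivity (\sum_(w : n.-tuple T | grade gam w == c) \sum_(s : 'S_n)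
   (num_id (n - j) s)%:R *
     (word (fun i => tnth w (s i)) == map tau w)%:R : rat).
  apply: eq_bigr => w _; rewrite -[X in delins _ _ X](word_tnth w) delins_perm // mulrA.
  by rewrite mulVf ?mul1r // pnatr_eq0 -lt0n fact_gt0.
rewrite exchange_big; apply: eq_bigr => s _; rewrite -mulr_sumr mulrC fE.
congr (_ * _); rewrite -sum1_card natr_sum big_mkcond [RHS]big_mkcond.
apply: eq_bigr => w _; rewrite inE; case: (_ == c) => //=.
suff -> : (word (fun i => tnth w (s i)) == map tau w) =
    [forall i, tnth w (s i) == tau (tnth w i)] by case: forallP.
rewrite -[in LHS](word_tnth w) -[map tau _]map_comp.
apply/eqP/forallP => [/eq_in_map E i|E].
  by apply/eqP/E; rewrite mem_enum.
by apply: eq_word => i; apply/eqP/E.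
Qed.

Lemma tracial_one : tracial 0 (fun _ _ => 1).
Proof.
exists unit, tt, 1%g, int, (fun=> 0), id, 0; split; first by split=> [||||[]] //; rewrite perm1.
split=> // n s; rewrite (_ : [set _ | _] = setT) ?cardsT ?card_tuple ?card_unit ?exp1n //.
apply/setP => w; rewrite !inE; apply/andP; split.
  by rewrite /grade big1.
by apply/forallP => i; case: (tnth w i) (_ (tnth w i)) => -[].
Qed.

(** A word over pairs of letters is a pair of words, and the pair of grades prescribes both grades
    at once. *)
Lemma tracial_mul a b f g : tracial a f -> tracial b g ->
  tracial (a + b) (fun n s => f n s * g n s).
Proof.
case=> [T [X [tau [M [gam [sz [c [[H1 H2 H3 H4 H5] [cE fE]]]]]]]]].
case=> [T' [X' [tau' [M' [gam' [sz' [c' [[H1' H2' H3' H4' H5'] [cE' gE]]]]]]]]].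
have tinj : injective (fun p : T * T' => (tau p.1, tau' p.2)).
  by move=> [x x'] [y y'] /= [/perm_inj -> /perm_inj ->].
have szX : forall x, 0 <= sz (gam x).
  move=> x; have [->|/H5] := eqVneq x X; last lia.
  by rewrite H2; have := H4 0 0; rewrite addr0; lia.
have szX' : forall x, 0 <= sz' (gam' x).
  move=> x; have [->|/H5'] := eqVneq x X'; last lia.
  by rewrite H2'; have := H4' 0 0; rewrite addr0; lia.
exists (T * T')%type, (X, X'), (perm tinj), (M * M')%type,
  (fun p => (gam p.1, gam' p.2)), (fun p => sz p.1 + sz' p.2), (c, c').
split; first split.
- by rewrite permE /= H1 H1'.
- by rewrite /= H2 H2'.
- by move=> [x x']; rewrite permE /= H3 H3'.
- by move=> [x x'] [y y'] /=; rewrite H4 H4' addrACA.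
- move=> [x x']; rewrite xpair_eqE negb_and /= => /orP[/H5|/H5'] H.
    by have := szX' x'; lia.
  by have := szX x; lia.
split=> [|n s]; first by rewrite /= cE cE'.
rewrite fE gE -natrM -cardsX.
pose h (w : n.-tuple (T * T')) := ([tuple of map fst w], [tuple of map snd w]).
have hinj : injective h.
  move=> w v wv; apply: eq_from_tnth => i.
  have := congr1 (fun p => (tnth p.1 i, tnth p.2 i)) wv.
  by rewrite /= !tnth_map; case: (tnth w i) (tnth v i) => x x' [y y'].
have gradeE (w : seq (T * T')) :
    grade (fun p => (gam p.1, gam' p.2)) w =
    (grade gam (map fst w), grade gam' (map snd w)).
  rewrite /grade !big_map; elim: w => [|x w IH]; first by rewrite !big_nil.
  by rewrite !big_cons IH.
have hE w : w \in [set w : n.-tuple (T * T') |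
      (grade (fun p => (gam p.1, gam' p.2)) w == (c, c')) &&
          [forall i, tnth w (s i) == perm tinj (tnth w i)]] =
    (h w \in setX
      [set w : n.-tuple T | (grade gam w == c) &&
          [forall i, tnth w (s i) == tau (tnth w i)]]
      [set w : n.-tuple T' | (grade gam' w == c') &&
          [forall i, tnth w (s i) == tau' (tnth w i)]]).
  rewrite !inE gradeE xpair_eqE /= andbACA; congr (_ && _).
  apply/forallP/andP => [E|[/forallP E /forallP E'] i].
    by split; apply/forallP => i; rewrite !tnth_map;
      move: (E i); rewrite permE /= => /eqP->.
  rewrite permE; move: (E i) (E' i); rewrite !tnth_map /= => /eqP<- /eqP<-.
  by rewrite -surjective_pairing.
rewrite -[in RHS](card_imset _ hinj); congr (_%:R); apply: eq_card => -[u u'].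
apply/idP/imsetP => [uu|[w Hw ->]]; last by rewrite -hE.
have hw : h [tuple (tnth u i, tnth u' i) | i < n] = (u, u').
  by congr pair; apply: eq_from_tnth => i; rewrite tnth_map tnth_mktuple.
by exists [tuple (tnth u i, tnth u' i) | i < n]; rewrite // hE hw.
Qed.

(** * Cycle counts as numbers of marked words *)

Section CycleMarkings.

Variables (r n : nat) (s : 'S_n).
Hypothesis r_gt0 : (0 < r)%N.

Let zero : 'I_r := Ordinal r_gt0.

Definition rot_letter (x : option 'I_r) : option 'I_r := omap (@ordS r) x.

Lemma rot_letter_inj : injective rot_letter.
Proof. by apply: inj_omap; apply: (can_inj (@ordSK r)). Qed.

(** The marked positions form a single [r]-cycle of [s], labelled cyclically; each [r]-cycle has [r]
    such labellings. *)
Definition markings : {set n.-tuple (option 'I_r)} :=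
  [set w : n.-tuple (option 'I_r) | (count isSome w == r) &&
     [forall i, tnth w (s i) == rot_letter (tnth w i)]].

Lemma marking_iter (w : n.-tuple (option 'I_r)) i a m : w \in markings ->
  tnth w i = Some a ->
  omap val (tnth w ((s ^+ m)%g i)) = Some ((a + m) %% r)%N.
Proof.
rewrite inE => /andP[_ /forallP E] wi; elim: m => [|m IH].
  by rewrite expg0 perm1 wi /= addn0 modn_small.
rewrite expgSr permM (eqP (E _)); case: (tnth _ _) IH => //= b [bE].
by rewrite bE -addn1 modnDml addn1 addnS.
Qed.

Lemma card_support (w : n.-tuple (option 'I_r)) :
  #|[set i | isSome (tnth w i)]| = count isSome w.
Proof.
rewrite -[in RHS](map_tnth_enum w) count_map -size_filter cardE.
by congr size; rewrite /enum_mem -filter_predI; apply: eq_filter => i;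
  rewrite /= !inE andbT.
Qed.

(** All [r] labels occur along the cycle of [i], so it has at least [r] points; all of them are
    marked, and only [r] positions are. *)
Lemma marking_support (w : n.-tuple (option 'I_r)) i : w \in markings ->
  tnth w i = Some zero ->
  porbit s i = [set k | isSome (tnth w k)] /\ #|porbit s i| = r.
Proof.
move=> wM wi; have it m := marking_iter m wM wi.
have suppr : #|[set k | isSome (tnth w k)]| = r.
  by move: wM; rewrite inE card_support => /andP[/eqP].
have sub : porbit s i \subset [set k | isSome (tnth w k)].
  apply/subsetP => k /porbitP[m ->]; rewrite inE.
  by have := it m; case: (tnth _ _).
have inj : injective (fun t : 'I_r => (s ^+ t)%g i).
  move=> t u /(congr1 (fun k => omap val (tnth w k))); rewrite !it.
  by rewrite !add0n !modn_small // => -[/val_inj].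
have le_r : (r <= #|porbit s i|)%N.
  rewrite -[X in (X <= _)%N](card_ord r) -(card_imset _ inj).
  by apply: subset_leq_card; apply/subsetP => _ /imsetP[t _ ->]; apply: mem_porbit.
have E : porbit s i = [set k | isSome (tnth w k)].
  by apply/eqP; rewrite eqEcard sub suppr.
by split; rewrite // E.
Qed.

Definition orbit_marking (i : 'I_n) : n.-tuple (option 'I_r) :=
  [tuple if k \in porbit s i then insub (index k (traject s i r)) else None
   | k < n].

Lemma orbit_markingP i : #|porbit s i| = r ->
  orbit_marking i \in markings /\ tnth (orbit_marking i) i = Some zero.
Proof.
move=> ir.
have idx m : index (iter m s i) (traject s i r) = (m %% r)%N.
  have perE q : iter (q * r) s i = i.
    by elim: q => // q IH; rewrite mulSn iterD IH -ir iter_porbit.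
  rewrite {1}(divn_eq m r) addnC iterD perE.
  rewrite -(nth_traject s (_ : m %% r < r)%N) ?ltn_mod //.
  by rewrite index_uniq ?size_traject ?ltn_mod // -ir uniq_traject_porbit.
have tE m : omap val (tnth (orbit_marking i) (iter m s i)) = Some (m %% r)%N.
  rewrite tnth_mktuple -permX mem_porbit permX idx.
  by rewrite insubT ?ltn_mod.
have zE : tnth (orbit_marking i) i = Some zero.
  have := tE 0%N; rewrite /= mod0n; case: (tnth _ _) => //= a [aE].
  by congr Some; apply: val_inj.
split=> //; rewrite inE; apply/andP; split.
  rewrite -card_support -[X in _ == X]ir; apply/eqP; apply: eq_card => k.
  rewrite inE tnth_mktuple; case: ifP => // /porbitP[m ->].
  by rewrite permX idx insubT ?ltn_mod.
apply/forallP => k; have [/porbitP[m ->]|ki] := boolP (k \in porbit s i).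
  rewrite permX -iterS; move: (tE m.+1) (tE m).
  case: (tnth _ _) => //= a [aE]; case: (tnth _ _) => //= b [bE].
  apply/eqP; congr Some; apply: val_inj.
  by rewrite /= aE bE -[(m %% r).+1]addn1 modnDml addn1.
rewrite !tnth_mktuple (negbTE ki).
have -> : (s k \in porbit s i) = false.
  apply/negbTE; apply: contra ki.
  by rewrite porbit_sym -[s k]/((s ^+ 1)%g k) porbit_perm porbit_sym.
by [].
Qed.

(** The position of the label zero determines the marking, so [orbit_marking i] is the only
    candidate. *)
Lemma card_markings_at i :
  (\sum_(w in markings) (tnth w i == Some zero) = (#|porbit s i| == r))%N.
Proof.
have [ir|ir] := eqVneq #|porbit s i| r; last first.
  apply: big1 => w wM; case: eqP => // wi.
  by have [_ /eqP] := marking_support wM wi; rewrite (negbTE ir).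
have [oM oi] := orbit_markingP ir.
rewrite (bigD1 (orbit_marking i)) //= oi eqxx big1 // => w /andP[wM wo].
case: eqP => // wi; case/eqP: wo; apply: eq_from_tnth => k.
have [wS _] := marking_support wM wi; have [oS _] := marking_support oM oi.
have [/porbitP[m ->]|] := boolP (k \in porbit s i).
  have := marking_iter m wM wi; have := marking_iter m oM oi.
  case: (tnth _ _) => //= a [aE]; case: (tnth _ _) => //= b [bE].
  by congr Some; apply: val_inj; rewrite /= aE bE.
move=> ki; move: (ki); rewrite wS; move: ki; rewrite oS !inE.
by case: (tnth _ _) => // _; case: (tnth _ _).
Qed.

Lemma sum_porbit_card :
  (\sum_i (#|porbit s i| == r) = r * num_cycles s r)%N.
Proof.
rewrite (partition_big (porbit s) (mem (porbits s))) => [|i _] /=; last first.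
  exact: imset_f.
rewrite /num_cycles mulnC -sum_nat_const big_mkcond [RHS]big_mkcond.
apply: eq_bigr => C _; rewrite !inE; case: ifP => //= /imsetP[k _ ->].
rewrite (eq_bigr (fun=> nat_of_bool (#|porbit s k| == r))) => [|i /eqP-> //].
rewrite sum_nat_const.
have -> : #|[pred i | porbit s i == porbit s k]| = #|porbit s k|.
  by apply: eq_card => i; rewrite inE eq_porbit_mem.
by case: eqP => [->|]; rewrite ?muln1 ?muln0.
Qed.

(** Double counting of the pairs of a marking and its unique position labelled zero. *)
Lemma card_markings : #|markings| = (r * num_cycles s r)%N.
Proof.
rewrite -sum_porbit_card; under [RHS]eq_bigr do rewrite -card_markings_at.
rewrite exchange_big /= -sum1_card; apply: eq_bigr => w wM.
have [i wi] : exists i, tnth w i = Some zero.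
  have : (0 < #|[set k | isSome (tnth w k)]|)%N.
    by rewrite card_support; move: wM; rewrite inE => /andP[/eqP->].
  case/card_gt0P => k; rewrite inE; case E: (tnth w k) => [a|] // _.
  (* From label [a], another [r - a] steps lead to label [r], which is zero modulo [r]. *)
  exists ((s ^+ (r - a))%g k); have := marking_iter (r - a) wM E.
  rewrite subnKC 1?ltnW // modnn; case: (tnth _ _) => //= b [b0].
  by congr Some; apply: val_inj.
rewrite (bigD1 i) //= wi eqxx big1 // => k ki; case: eqP => // wk.
have [wS ir] := marking_support wM wi.
have : k \in porbit s i by rewrite wS inE wk.
rewrite porbit_traject ir => /trajectP[t t_r kE].
have := marking_iter t wM wi; rewrite permX -kE wk add0n modn_small // => -[t0].
by case/eqP: ki; rewrite kE -t0.
Qed.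

End CycleMarkings.

Lemma tracial_cycle r : (0 < r)%N ->
  tracial r (fun n s => r%:R * (num_cycles s r)%:R).
Proof.
move=> r0; exists (option 'I_r), None, (perm (@rot_letter_inj r)), int,
  (fun x => (isSome x)%:R), id, r%:Z; split; first split=> //.
- by rewrite permE.
- by move=> x; rewrite permE; case: x.
- by case.
split=> // n s; rewrite -natrM -(card_markings s r0); congr (_%:R).
apply: eq_card => w; rewrite !inE; congr (_ && _).
  rewrite /grade; have -> : \sum_(x <- w) (isSome x)%:R = (count isSome w)%:Z :> int.
    by elim: (tval w) => [|x v IH]; rewrite ?big_nil // big_cons IH natz.
  by rewrite eqz_nat.
by apply: eq_forallb => i; rewrite permE.
Qed.

(** * Polynomials in the cycle counts *)

(** Polynomials in the cycle counts of weighted degree at most [d], where the number of [r]-cycles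
    has weight [r]; they are built up one factor at a time. *)
Inductive cycle_poly : nat -> class_family -> Prop :=
| cycle_poly_const q : cycle_poly 0 (fun _ _ => q)
| cycle_polyD d f g : cycle_poly d f -> cycle_poly d g ->
    cycle_poly d (fun n s => f n s + g n s)
| cycle_poly_mul d r f : (0 < r)%N -> cycle_poly d f ->
    cycle_poly (r + d) (fun n s => (num_cycles s r)%:R * f n s)
| cycle_poly_mono d d' f : (d <= d')%N -> cycle_poly d f -> cycle_poly d' f
| cycle_poly_ext d f g : (forall n (s : 'S_n), f n s = g n s) ->
    cycle_poly d f -> cycle_poly d g.

Lemma cycle_polyZ d q f : cycle_poly d f -> cycle_poly d (fun n s => q * f n s).
Proof.
elim=> {d f} [q'|d f g _ IHf _ IHg|d r f r0 _ IH|d d' f dd _ IH|d f g fg _ IH].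
- exact: cycle_poly_const.
- by apply: cycle_poly_ext (cycle_polyD IHf IHg) => n s; rewrite mulrDr.
- by apply: cycle_poly_ext (cycle_poly_mul r0 IH) => n s; rewrite mulrCA.
- exact: cycle_poly_mono dd IH.
- by apply: cycle_poly_ext IH => n s; rewrite fg.
Qed.

Lemma cycle_poly_sum d (I : eqType) (r : seq I) (F : I -> class_family) :
  (forall i, i \in r -> cycle_poly d (F i)) ->
  cycle_poly d (fun n s => \sum_(i <- r) F i n s).
Proof.
elim: r => [_|i r IH H].
  have := cycle_poly_mono (leq0n d) (cycle_poly_const 0).
  by apply: cycle_poly_ext => n s; rewrite big_nil.
have Hr : cycle_poly d (fun n s => \sum_(i <- r) F i n s).
  by apply: IH => k kr; apply: H; rewrite inE kr orbT.
have := cycle_polyD (H i (mem_head i r)) Hr.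
by apply: cycle_poly_ext => n s; rewrite big_cons.
Qed.

Lemma cycle_poly_bin d r k f : (0 < r)%N -> cycle_poly d f ->
  cycle_poly (k * r + d) (fun n s => 'C(num_cycles s r, k)%:R * f n s).
Proof.
move=> r0 Hf; elim: k => [|k IH].
  by apply: cycle_poly_ext Hf => n s; rewrite bin0 mul1r.
have H1 := cycle_poly_mul r0 IH.
have H2 := cycle_poly_mono (leq_addl r _) (cycle_polyZ (- k%:R) IH).
have := cycle_polyZ k.+1%:R^-1 (cycle_polyD H1 H2).
rewrite mulSn -addnA; apply: cycle_poly_ext => n s.
rewrite -mulrDl mulrA mulrA; congr (_ * _).
apply: (mulfI (_ : k.+1%:R != 0 :> rat)); first by rewrite pnatr_eq0.
rewrite !mulrA mulfV ?pnatr_eq0 // mul1r -natrM mul_bin_left natrM.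
(* The subtraction in [mul_bin_left] is truncated when [k] exceeds the count, but then the binomial
   coefficient vanishes. *)
have [km|mk] := leqP k (num_cycles s r); first by rewrite natrB.
by rewrite bin_small // !mulr0.
Qed.

(** The left side is the weight of the product defining [Ipoly rho]; parts of size at least [N] are
    missed, hence an inequality. *)
Lemma count_mem_sum_leq (rho : seq nat) N :
  (\sum_(1 <= j < N) count_mem j rho * j <= sumn rho)%N.
Proof.
elim: rho => [|x rho IH] /=.
  by rewrite big1.
under eq_bigr do rewrite mulnDl; rewrite big_split /= leq_add //.
rewrite (eq_bigr (fun j => if j == x then j else 0%N)) => [|j _].
  by rewrite -big_mkcond big_nat1_eq; case: ifP.
by rewrite eq_sym; case: eqP; rewrite ?mul1n ?mul0n.
Qed.

Lemma cycle_poly_Ipoly (rho : seq nat) : cycle_poly (sumn rho) (@Ipoly rho).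
Proof.
apply: cycle_poly_mono (count_mem_sum_leq rho (sumn rho).+1) _.
rewrite /Ipoly; elim: (sumn rho) => [|N IH].
  rewrite big_geq //; apply: cycle_poly_ext (cycle_poly_const 1) => n s.
  by rewrite big_geq.
have := cycle_poly_bin (count_mem N.+1 rho) (ltn0Sn N) IH.
rewrite addnC -big_nat_recr //; apply: cycle_poly_ext => n s.
by rewrite [RHS]big_nat_recr //= mulrC.
Qed.

Lemma cycle_poly_Xpoly la : cycle_poly (sumn la) (@Xpoly la).
Proof.
rewrite /Xpoly; have := @cycle_poly_sum (sumn la) _
  (index_enum 'I_(sumn la).+1) (fun d n s => \sum_(mu <- partitions d | vstrip mu la)
     (-1) ^+ (sumn la - sumn mu) * Ypoly mu s); apply => d _.
have := @cycle_poly_sum (sumn la) _ [seq mu <- partitions d | vstrip mu la]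
  (fun mu n s => (-1) ^+ (sumn la - sumn mu) * Ypoly mu s) => H.
apply: cycle_poly_ext (H _) => [n s|mu]; first by rewrite big_filter.
rewrite !mem_filter => /and3P[_ /andP[_ /eqP mu_d] _].
apply: cycle_polyZ; apply: (@cycle_poly_sum _ _ _
  (fun rho n s => chi mu rho * Ipoly rho s)) => rho.
rewrite mem_filter => /andP[/andP[_ /eqP rho_mu] _]; apply: cycle_polyZ.
apply: cycle_poly_mono (cycle_poly_Ipoly rho).
by rewrite rho_mu mu_d -ltnS.
Qed.

(** The extra tracial factor [g] accumulates the cycle counts: [r] times the number of [r]-cycles is
    tracial, so multiplying by a count amounts to enlarging [g]. *)
Lemma cycle_poly_counting d f : cycle_poly d f -> forall a g, tracial a g ->
  poly_counting (d + a) (fun n s => f n s * g n s).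
Proof.
elim=> {d f} [q|d f f' _ IHf _ IHf'|d r f r0 _ IH|d d' f dd _ IH|d f f' ff _ IH] a g Hg j.
- have := poly_fromZ q (tracial_poly Hg j); apply: poly_from_ext => n _.
  by rewrite mulr_sumr; apply: eq_bigr => s _; rewrite mulrA.
- have := poly_fromD (IHf a g Hg j) (IHf' a g Hg j).
  apply: poly_from_ext => n _; rewrite -big_split; apply: eq_bigr => s _ /=.
  by rewrite -mulrDl -mulrDl.
- have := IH _ _ (tracial_mul (tracial_cycle r0) Hg) j.
  rewrite addnCA addnA => /(poly_fromZ (r%:R^-1)); apply: poly_from_ext => n _.
  rewrite mulr_sumr; apply: eq_bigr => s _; rewrite mulrA; congr (_ * _).
  have r_neq0 : r%:R != 0 :> rat by rewrite pnatr_eq0 -lt0n.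
  by field.
- by apply: poly_from_mono (IH a g Hg j); lia.
- have := IH a g Hg j; apply: poly_from_ext => n _.
  by apply: eq_bigr => s _; rewrite ff.
Qed.

Theorem theorem1p6 (la : seq nat) (j : nat)
    (la_part : is_part la) (la_pos : (1 <= sumn la)%N) :
  exists b : {poly rat},
    (size b <= (sumn la + 2 * j).+1)%N /\
    forall n : nat, (maxn j (sumn la - 1) <= n)%N ->
      A_id la n (n - j) = b.[n%:R] / n`!%:R.
Proof.
have [b [sb bE]] := cycle_poly_counting (cycle_poly_Xpoly la) tracial_one j.
rewrite addn0 in sb; exists b; split=> // n; rewrite subn1 => jn.
rewrite /A_id mulrC -bE ?addn0 //; congr (_ / _).
by apply: eq_bigr => s _; rewrite mulr1.
Qed.
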